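(* Suppose that $(x,y)\in P\cap\mathbb{R}^{m+s}_{++}$ and let $(\theta^*,\phi^* )$ be an optimal solution of the max RM DEA model for $(x,y)$. Then the projection point $\big(\sum_{i=1}^m\theta^*_ix_ie_i,\ \sum_{r=1}^s\phi^*_ry_re_r\big)$ is either an input-oriented closest target of $(x,y)$ or an output-oriented closest target of $(x,y)$. Moreover, $\sum_{i=1}^m\theta^*_ix_ie_i\in\mathbb{R}^m_{++}$, and $\big(\sum_{i=1}^m\theta^*_ix_ie_i,\ \sum_{r=1}^s\phi^*_ry_re_r\big)$ is not a free-lunch vector of $P_{EXFA}$.
   Context: Notation: vector inequalities are componentwise ($a\le b$ means $a_i\le b_i$ for all $i$; $a<b$ means $a_i<b_i$ for all $i$). $\mathbb{R}_+$ denotes the nonnegative reals and $\mathbb{R}_{++}$ the positive reals. $e_l$ is the $l$-th unit vector and $e$ the all-ones vector of the space of appropriate dimension. Let $m,s,n\ge 1$ be integers. Data: observed input-output vectors $(x_j,y_j)\in\mathbb{R}^{m+s}_{++}$, $j=1,\dots,n$ (with $x_j\in\mathbb{R}^m$, $y_j\in\mathbb{R}^s$). The production possibility set (variable returns to scale) is $$P=\Big\{(x,y)\in\mathbb{R}^{m+s}_+ : \exists \lambda\ge 0,\ \sum_{j=1}^n\lambda_jx_j\le x,\ \sum_{j=1}^n\lambda_jy_j\ge y,\ \sum_{j=1}^n\lambda_j=1\Big\}.$$ For a set $\mathcal{P}\subseteq\mathbb{R}^{m+s}_+$, the weakly efficient frontier $\partial^w(\mathcal{P})$ is the set of $(x,y)\in\mathcal{P}$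 such that $(x',-y')<(x,-y)$ implies $(x',y')\notin\mathcal{P}$; the strongly efficient frontier $\partial^s(\mathcal{P})$ is the set of $(x,y)\in\mathcal{P}$ such that $(x',y')\ne(x,y)$ and $(x',-y')\le(x,-y)$ imply $(x',y')\notin\mathcal{P}$. A face of $P$ is a set $\mathcal{F}=P\cap\{(x,y): -v^\top x+u^\top y-\psi=0\}$ with $(v,u,\psi)\in\mathbb{R}^{m+s}_+\times\mathbb{R}$ such that $-v^\top x+u^\top y-\psi\le 0$ for all $(x,y)\in P$. A full-dimensional efficient facet (FDEF) of $P$ is a face $\mathcal{F}\subseteq\partial^s(P)$ with $\dim\mathcal{F}=m+s-1$. Assume $P$ has at least one FDEF, and let $\mathcal{F}_1,\dots,\mathcal{F}_K$ be all the FDEFs of $P$. For each $k$ there are $(v^k,u^k)\in\mathbb{R}^{m+s}_{++}$ and $\psi^k\in\mathbb{R}$ with $\mathcal{F}_k=P\cap\{(x,y): -v^{k\top}x+u^{k\top}y-\psi^k=0\}$ and $-v^{k\top}x+u^{k\top}y-\psi^k\le0$ on $P$. The extended facet production possibility set is $$P_{EXFA}=\Big\{(x,y)\in\mathbb{R}^{m+s}_+ : -\sum_{i=1}^m v^k_ix_i+\sum_{r=1}^s u^k_ry_r\le\psi^k,\ k=1,\dots,K\Big\}.$$ The max RM DEA model for $(x,y)\in P\cap\mathbb{R}^{m+s}_{++}$ is the problem of maximizing $\frac{1}{m+s}\big(\sum_{i=1}^m\theta_i+\sum_{r=1}^s\frac{1}{\phi_r}\big)$ over all $(\theta,\phi)$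 with $0\le\theta_i\le1$ ($i=1,\dots,m$), $1\le\phi_r$ ($r=1,\dots,s$) and $\big(\sum_{i=1}^m\theta_ix_ie_i,\sum_{r=1}^s\phi_ry_re_r\big)\in\partial^s(P_{EXFA})$. The commensurable Hölder input and output distance functions are $$D^-(x,y)=\min\Big\{\sum_{i=1}^m(1-\theta_i) : \Big(\sum_{i=1}^m\theta_ix_ie_i,\,y\Big)\in\partial^w(P_{EXFA}),\ 0\le\theta\le e\Big\},$$ $$D^+(x,y)=\min\Big\{\sum_{r=1}^s(\phi_r-1) : \Big(x,\,\sum_{r=1}^s\phi_ry_re_r\Big)\in\partial^w(P_{EXFA}),\ e\le\phi\Big\}.$$ An input-oriented closest target of $(x,y)$ is a point $\big(\sum_{i=1}^m\theta_ix_ie_i,\,y\big)$ where $\theta$ is an optimal solution of the problem defining $D^-(x,y)$; an output-oriented closest target of $(x,y)$ is a point $\big(x,\sum_{r=1}^s\phi_ry_re_r\big)$ where $\phi$ is an optimal solution of the problem defining $D^+(x,y)$. (''Either ... or'' is inclusive.) A free-lunch vector of $P_{EXFA}$ is a vector $(0,y)\in P_{EXFA}$ with $y\in\mathbb{R}^s_+\setminus\{0\}$. *)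

(* Defs.v *)
From HB Require Import structures.
From mathcomp Require Import all_boot all_order all_algebra.
From mathcomp Require Import classical_sets reals.

Set Implicit Arguments.
Unset Strict Implicit.
Unset Printing Implicit Defensive.

Import Order.TTheory GRing.Theory Num.Theory.
Local Open Scope classical_set_scope.
Local Open Scope ring_scope.

(* [vlt] is strict in every component: it is not the strict part of [vle]. *)
Definition vle (R : realType) (d : nat) (a b : 'rV[R]_d) : Prop :=
  forall i, a 0 i <= b 0 i.
Definition vlt (R : realType) (d : nat) (a b : 'rV[R]_d) : Prop :=
  forall i, a 0 i < b 0 i.

Definition dotv (R : realType) (d : nat) (a b : 'rV[R]_d) : R :=
  \sum_i a 0 i * b 0 i.

(* \sum_i t_i a_i e_i *)
Definition scalev (R : realType) (d : nat) (t a : 'rV[R]_d) : 'rV[R]_d :=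
  \row_i (t 0 i * a 0 i).

(* An input-output vector (x, y) of R^(m+s) is a pair: p.1 = x, p.2 = y. *)
Notation iovec R m s := ('rV[R]_m * 'rV[R]_s)%type.

Section AffineDimension.
Variables (R : realType) (V : vectType R).

Definition aff_hull (S : set V) : set V :=
  [set p | exists (k : nat) (a : 'I_k -> R) (z : 'I_k -> V),
     [/\ forall i, S (z i), \sum_i a i = 1 & p = \sum_i a i *: z i]].

(* No [d] qualifies when [S] is empty. *)
Definition aff_dim (S : set V) (d : nat) : Prop :=
  exists (z : V) (U : {vspace V}),
    \dim U = d /\ aff_hull S = [set p | p - z \in U].

End AffineDimension.

Section Optimization.
Variables (R : realType) (T : Type).

Definition is_argmax (f : T -> R) (D : set T) (t : T) : Prop :=
  D t /\ forall t', D t' -> f t' <= f t.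
Definition is_argmin (f : T -> R) (D : set T) (t : T) : Prop :=
  D t /\ forall t', D t' -> f t <= f t'.

End Optimization.

Section DEA.
Variables (R : realType) (m s : nat).

Definition pps (n : nat) (X : 'I_n -> 'rV[R]_m) (Y : 'I_n -> 'rV[R]_s) :
    set (iovec R m s) :=
  [set p | [/\ vle 0 p.1, vle 0 p.2 &
     exists lambda : 'I_n -> R,
       [/\ forall j, 0 <= lambda j,
           vle (\sum_j lambda j *: X j) p.1,
           vle p.2 (\sum_j lambda j *: Y j) &
           \sum_j lambda j = 1]]].

Definition weak_frontier (P : set (iovec R m s)) : set (iovec R m s) :=
  [set p | P p /\
     forall q, vlt q.1 p.1 /\ vlt (- q.2) (- p.2) -> ~ P q].

Definition strong_frontier (P : set (iovec R m s)) : set (iovec R m s) :=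
  [set p | P p /\
     forall q, q <> p -> vle q.1 p.1 /\ vle (- q.2) (- p.2) -> ~ P q].

Definition hyp (v : 'rV[R]_m) (u : 'rV[R]_s) (psi : R) (p : iovec R m s) : R :=
  - dotv v p.1 + dotv u p.2 - psi.

Definition supports (P : set (iovec R m s))
    (v : 'rV[R]_m) (u : 'rV[R]_s) (psi : R) : Prop :=
  forall p, P p -> hyp v u psi p <= 0.

Definition cut (P : set (iovec R m s))
    (v : 'rV[R]_m) (u : 'rV[R]_s) (psi : R) : set (iovec R m s) :=
  P `&` [set p | hyp v u psi p = 0].

Definition is_face (P F : set (iovec R m s)) : Prop :=
  exists (v : 'rV[R]_m) (u : 'rV[R]_s) (psi : R),
    [/\ vle 0 v, vle 0 u, supports P v u psi & F = cut P v u psi].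

Definition is_FDEF (P F : set (iovec R m s)) : Prop :=
  [/\ is_face P F, F `<=` strong_frontier P & aff_dim F (m + s - 1)%N].

Definition pps_exfa (K : nat) (v : 'I_K -> 'rV[R]_m) (u : 'I_K -> 'rV[R]_s)
    (psi : 'I_K -> R) : set (iovec R m s) :=
  [set p | [/\ vle 0 p.1, vle 0 p.2 &
     forall k, - dotv (v k) p.1 + dotv (u k) p.2 <= psi k]].

(* In the following definitions T plays the role of P_EXFA. *)

Definition project (p tp : iovec R m s) : iovec R m s :=
  (scalev tp.1 p.1, scalev tp.2 p.2).

Definition max_rm_obj (tp : iovec R m s) : R :=
  ((m + s)%:R)^-1 * (\sum_i tp.1 0 i + \sum_r (tp.2 0 r)^-1).

Definition max_rm_feasible (T : set (iovec R m s)) (p : iovec R m s) :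
    set (iovec R m s) :=
  [set tp | [/\ vle 0 tp.1, vle tp.1 (const_mx 1), vle (const_mx 1) tp.2 &
     strong_frontier T (project p tp)]].

Definition max_rm_optimal (T : set (iovec R m s)) (p : iovec R m s) :
    iovec R m s -> Prop :=
  is_argmax max_rm_obj (max_rm_feasible T p).

(* The feasible sets and objectives of the problems defining D^- and D^+. *)
Definition holder_in_feasible (T : set (iovec R m s)) (p : iovec R m s) :
    set 'rV[R]_m :=
  [set theta | [/\ weak_frontier T (scalev theta p.1, p.2),
     vle 0 theta & vle theta (const_mx 1)]].
Definition holder_in_obj (theta : 'rV[R]_m) : R := \sum_i (1 - theta 0 i).

Definition holder_out_feasible (T : set (iovec R m s)) (p : iovec R m s) :
    set 'rV[R]_s :=
  [set phi | weak_frontier T (p.1, scalev phi p.2) /\ vle (const_mx 1) phi].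
Definition holder_out_obj (phi : 'rV[R]_s) : R := \sum_r (phi 0 r - 1).

Definition input_closest_target (T : set (iovec R m s)) (p t : iovec R m s) :
    Prop :=
  exists theta, is_argmin holder_in_obj (holder_in_feasible T p) theta /\
    t = (scalev theta p.1, p.2).

Definition output_closest_target (T : set (iovec R m s)) (p t : iovec R m s) :
    Prop :=
  exists phi, is_argmin holder_out_obj (holder_out_feasible T p) phi /\
    t = (p.1, scalev phi p.2).

Definition free_lunch (T : set (iovec R m s)) (t : iovec R m s) : Prop :=
  [/\ T t, t.1 = 0, vle 0 t.2 & t.2 <> 0].

End DEA.

(* Main.v *)
Require Import Defs.
From mathcomp Require Import all_boot all_order all_algebra.
From mathcomp Require Import classical_sets reals.
From mathcomp Require Import boolp ring lra.

Set Implicit Arguments.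
Unset Strict Implicit.
Unset Printing Implicit Defensive.

Import Order.TTheory GRing.Theory Num.Theory.
Local Open Scope classical_set_scope.
Local Open Scope ring_scope.

(** Write c_k >= 0 for the slack of the k-th facet inequality at (x, y), and put
    delta = 1 - theta, eta = phi - 1.  Because all v^k and u^k are positive, the
    strong frontier of the extended set T consists of the points of T lying on
    one of its K hyperplanes ([strong_frontier_exfaP]), and the same holds for
    the weak frontier as long as all inputs are positive
    ([weak_strong_frontier_exfa]).  So in the coordinates (delta, eta) >= 0 the
    max RM model minimises

      loss = sum_i delta_i + sum_r eta_r / (1 + eta_r)

    over the points with delta <= 1 where A (delta, eta) <= c, with A > 0, is
    active.  The loss is concave, vanishes at 0, and is strictly concave in each
    eta_r but linear in delta; hence a minimiser either moves inputs only or
    lies on the axis of a single output.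

    Quantitatively, let mu be the optimal loss.  Comparing the optimum with the
    points where a single coordinate axis meets the boundary gives mu < 1 (an
    output axis has loss eta / (1 + eta) < 1) and bounds each column of A by
    multiples of c ([optimal_loss_bounds]).  On an active hyperplane k these
    bounds add up to

      c_k mu <= c_k (sum_i delta_i + (1 - mu) sum_r eta_r).

    If eta <> 0, then c_k > 0 may be cancelled, so that
    sum_r eta_r / (1 + eta_r) <= (1 - mu) sum_r eta_r; but every term of the
    left-hand side is at least that of the right-hand side, as
    eta_r / (1 + eta_r) <= mu.  Equality must hold termwise, so an output with
    eta_r > 0 carries the whole loss mu, whence delta = 0.  The displayed
    inequality, valid for every boundary point, then says that eta has minimal
    sum among output moves.  If eta = 0, the optimum is a pure input move; it
    beats all competitors of the input problem, since these are feasible for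
    the max RM model unless they annihilate an input, which costs at least
    1 > mu.  The inequality mu < 1 also forbids the optimum itself from
    annihilating an input, so the target is not a free lunch. *)

(** * Monotonicity of the pairing with a positive vector *)

Lemma dotv_ge0 (R : realType) (d : nat) (a b : 'rV[R]_d) :
  vle 0 a -> vle 0 b -> 0 <= dotv a b.
Proof.
move=> a0 b0; apply: sumr_ge0 => i _; apply: mulr_ge0.
  by have := a0 i; rewrite mxE.
by have := b0 i; rewrite mxE.
Qed.

Lemma dotv_addZ (R : realType) (d : nat) (e : R) (a b c : 'rV[R]_d) :
  dotv a (b + e *: c) = dotv a b + e * dotv a c.
Proof.
rewrite /dotv mulr_sumr -big_split /=; apply: eq_bigr => i _.
by rewrite !mxE; ring.
Qed.

Lemma dotv_le (R : realType) (d : nat) (a b c : 'rV[R]_d) :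
  vle 0 a -> vle b c -> dotv a b <= dotv a c.
Proof.
move=> a0 bc; apply: ler_sum => i _; apply: ler_wpM2l (bc i).
by have := a0 i; rewrite mxE.
Qed.

Lemma dotv_le_eq (R : realType) (d : nat) (a b c : 'rV[R]_d) :
  vlt 0 a -> vle b c -> dotv a c <= dotv a b -> b = c.
Proof.
move=> a0 bc le_cb; apply/rowP => i.
have t0 j : 0 <= a 0 j * (c 0 j - b 0 j).
  by apply: mulr_ge0; [have := a0 j; rewrite mxE => /ltW | rewrite subr_ge0 bc].
have /eqP : \sum_j a 0 j * (c 0 j - b 0 j) = 0.
  apply/eqP; rewrite eq_le sumr_ge0 ?andbT => [|j _]; last exact: t0.
  under eq_bigr do rewrite mulrBr.
  by rewrite sumrB subr_le0.
rewrite psumr_eq0 => [/allP /(_ i (mem_index_enum i))|j _]; last exact: t0.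
have := a0 i; rewrite mxE => ai.
by rewrite mulf_eq0 gt_eqF //= subr_eq0 => /eqP ->.
Qed.

Lemma vlt_vle (R : realType) (d : nat) (a b : 'rV[R]_d) : vlt a b -> vle a b.
Proof. by move=> ab i; apply: ltW. Qed.

(** * Frontiers of the extended facet set *)

Lemma pps_exfaE (R : realType) (m s K : nat) (v : 'I_K -> 'rV[R]_m)
    (u : 'I_K -> 'rV[R]_s) (psi : 'I_K -> R) (p : iovec R m s) :
  pps_exfa v u psi p <->
  [/\ vle 0 p.1, vle 0 p.2 & forall k, hyp (v k) (u k) (psi k) p <= 0].
Proof.
by split=> -[? ? H]; split=> // k; have := H k; rewrite /hyp subr_le0.
Qed.

Lemma common_step (R : realType) (K : nat) (b d : 'I_K -> R) :
  (forall k, 0 <= b k) -> (forall k, 0 < d k) ->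
  exists e, [/\ 0 < e, e <= 1 & forall k, e * b k <= d k].
Proof.
move=> b0 d0; exists (\big[Order.min/1]_k (d k / (b k + 1))).
have b1 k : 0 < b k + 1 by rewrite ltr_wpDl.
have e0 : 0 < \big[Order.min/1]_k (d k / (b k + 1)).
  elim/big_ind: _ => [|a c a0 c0|k _]; first exact: ltr01.
    by rewrite lt_min a0.
  by rewrite divr_gt0.
split=> // [|k]; first exact: bigmin_le_id.
have : \big[Order.min/1]_k (d k / (b k + 1)) <= d k / (b k + 1).
  exact: bigmin_le.
rewrite ler_pdivlMr //; apply: le_trans.
by rewrite ler_wpM2l ?(ltW e0) // lerDl.
Qed.

(** A point off all hyperplanes can be improved inside T.  The direction [w] of
    the input decrease is kept free: [w = 0] refutes strong efficiency at any
    such point, [w = p.1] refutes weak efficiency when the inputs are positive.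
    The bound [w <= p.1] together with a step at most 1 keeps inputs
    nonnegative. *)
Lemma interior_step (R : realType) (m s K : nat) (v : 'I_K -> 'rV[R]_m)
    (u : 'I_K -> 'rV[R]_s) (psi : 'I_K -> R) (p : iovec R m s) (w : 'rV[R]_m) :
  (forall k, vlt 0 (v k)) -> (forall k, vlt 0 (u k)) ->
  pps_exfa v u psi p -> (forall k, hyp (v k) (u k) (psi k) p != 0) ->
  vle 0 w -> vle w p.1 ->
  exists2 e, 0 < e & pps_exfa v u psi (p.1 - e *: w, p.2 + e *: const_mx 1).
Proof.
move=> v0 u0 /pps_exfaE[p1 p2 Hp] nb w0 wp.
have one0 : vle 0 (const_mx 1 : 'rV[R]_s) by move=> r; rewrite !mxE.
pose b k := dotv (v k) w + dotv (u k) (const_mx 1).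
have [e [e0 e1 He]] : exists e, [/\ 0 < e, e <= 1 &
    forall k, e * b k <= - hyp (v k) (u k) (psi k) p].
  apply: common_step => k.
    by apply: addr_ge0; apply: dotv_ge0 => //; apply: vlt_vle.
  by rewrite oppr_gt0 lt_neqAle nb Hp.
exists e => //; apply/pps_exfaE; split=> [i|r|k] /=.
- have := wp i; have := w0 i; rewrite !mxE => wi0 wi; rewrite subr_ge0.
  by apply: le_trans wi; rewrite ler_piMl.
- by have := p2 r; rewrite !mxE mulr1 => p2r; rewrite addr_ge0 // ltW.
- have := He k; rewrite /b /hyp /= -scaleNr !dotv_addZ; lra.
Qed.

(** On a hyperplane with positive normals, improving a point strictly in some
    coordinate and weakly in the others strictly increases [hyp]; off all of
    them, the outputs can be raised. *)
Lemma strong_frontier_exfaP (R : realType) (m s K : nat) (v : 'I_K -> 'rV[R]_m)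
    (u : 'I_K -> 'rV[R]_s) (psi : 'I_K -> R) (p : iovec R m s) :
  (0 < s)%N -> (forall k, vlt 0 (v k)) -> (forall k, vlt 0 (u k)) ->
  strong_frontier (pps_exfa v u psi) p <->
  pps_exfa v u psi p /\ exists k, hyp (v k) (u k) (psi k) p = 0.
Proof.
move=> s_gt0 v0 u0; split=> -[Tp].
  move=> eff; split=> //; apply: contrapT => nb.
  have [k|i|i|e e0 Tq] := @interior_step R m s K v u psi p 0 v0 u0 Tp.
  - by apply/eqP => Hk; apply: nb; exists k.
  - by rewrite !mxE.
  - by have [] := Tp.
  have r0 := Ordinal s_gt0.
  apply: (eff _ _ _ Tq) => [/(congr1 (fun q : iovec R m s => q.2 0 r0))|].
    by rewrite !mxE mulr1 => /eqP; rewrite -subr_eq0 addrAC subrr add0r gt_eqF.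
  by split=> i /=; rewrite !mxE ?mulr0 ?subr0 // mulr1 lerN2 lerDl ltW.
move=> [k Hk]; split=> // q neq [q1 q2] /pps_exfaE[_ _ /(_ k)].
move: Hk; rewrite /hyp => Hp Hq; apply: neq.
have q2' : vle p.2 q.2 by move=> r; have := q2 r; rewrite !mxE lerN2.
have l1 := dotv_le (vlt_vle (v0 k)) q1.
have l2 := dotv_le (vlt_vle (u0 k)) q2'.
have e1 : q.1 = p.1 by apply: (dotv_le_eq (v0 k) q1); lra.
have e2 : p.2 = q.2 by apply: (dotv_le_eq (u0 k) q2'); lra.
by case: p q e1 e2 {Tp Hp Hq q1 q2 q2' l1 l2} => ? ? [? ?] /= -> ->.
Qed.

Lemma strong_weak_frontier (R : realType) (m s : nat) (P : set (iovec R m s))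
    (p : iovec R m s) : (0 < m)%N ->
  strong_frontier P p -> weak_frontier P p.
Proof.
move=> m_gt0 [Pp eff]; split=> // q [q1 q2]; apply: eff.
  by move=> qp; have := q1 (Ordinal m_gt0); rewrite qp ltxx.
by split; apply: vlt_vle.
Qed.

(** Positivity of the inputs cannot be dropped: a point of T with a zero input
    is weakly efficient because no point of T is strictly below it in that
    input. *)
Lemma weak_strong_frontier_exfa (R : realType) (m s K : nat)
    (v : 'I_K -> 'rV[R]_m) (u : 'I_K -> 'rV[R]_s) (psi : 'I_K -> R)
    (p : iovec R m s) :
  (0 < s)%N -> (forall k, vlt 0 (v k)) -> (forall k, vlt 0 (u k)) ->
  vlt 0 p.1 ->
  weak_frontier (pps_exfa v u psi) p -> strong_frontier (pps_exfa v u psi) p.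
Proof.
move=> s_gt0 v0 u0 p1 [Tp eff]; apply/strong_frontier_exfaP => //; split=> //.
apply: contrapT => nb.
have [k||i|e e0 Tq] := @interior_step R m s K v u psi p p.1 v0 u0 Tp.
- by apply/eqP => Hk; apply: nb; exists k.
- exact: vlt_vle.
- by [].
apply: (eff _ _ Tq); split=> i /=; rewrite !mxE ?mulr1.
  by have := p1 i; rewrite mxE => ?; rewrite ltrBlDr ltrDl mulr_gt0.
by rewrite ltrN2 ltrDl.
Qed.

(** * The max RM model as a minimisation of losses *)

Lemma hyp_project (R : realType) (m s : nat) (v : 'rV[R]_m) (u : 'rV[R]_s)
    (psi : R) (p tp : iovec R m s) :
  hyp v u psi (project p tp) = hyp v u psi p +
    (\sum_i v 0 i * p.1 0 i * (1 - tp.1 0 i) +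
     \sum_r u 0 r * p.2 0 r * (tp.2 0 r - 1)).
Proof.
have -> : \sum_i v 0 i * p.1 0 i * (1 - tp.1 0 i) =
    dotv v p.1 - dotv v (scalev tp.1 p.1).
  by rewrite /dotv -sumrB; apply: eq_bigr => i _; rewrite mxE; ring.
have -> : \sum_r u 0 r * p.2 0 r * (tp.2 0 r - 1) =
    dotv u (scalev tp.2 p.2) - dotv u p.2.
  by rewrite /dotv -sumrB; apply: eq_bigr => i _; rewrite mxE; ring.
by rewrite /hyp /project /=; ring.
Qed.

(** The point where one coordinate axis leaves the polytope: the smallest of
    the ratios [c k / a k]. *)
Lemma intercept (R : realType) (K : nat) (k0 : 'I_K) (a c : 'I_K -> R) :
  (forall k, 0 < a k) -> (forall k, 0 <= c k) ->
  exists N, [/\ 0 <= N, forall k, a k * N <= c k & exists k, a k * N = c k].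
Proof.
move=> a0 c0.
have [k _ kmin] := Order.TotalTheory.arg_minP (fun k => c k / a k)
  (isT : xpredT k0).
exists (c k / a k); split.
- by rewrite divr_ge0 // ltW.
- by move=> j; rewrite mulrC -ler_pdivlMr // kmin.
- by exists k; rewrite mulrCA divff ?mulr1 // gt_eqF.
Qed.

Definition loss (R : realType) (m s : nat) (tp : iovec R m s) : R :=
  \sum_i (1 - tp.1 0 i) + \sum_r (1 - (tp.2 0 r)^-1).

Lemma max_rm_obj_loss (R : realType) (m s : nat) (tp tp' : iovec R m s) :
  (0 < s)%N -> max_rm_obj tp <= max_rm_obj tp' -> loss tp' <= loss tp.
Proof.
move=> s_gt0; rewrite /max_rm_obj ler_pM2l; last first.
  by rewrite invr_gt0 ltr0n addn_gt0 s_gt0 orbT.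
by rewrite /loss !sumrB; lra.
Qed.

Lemma max_rm_feasible_exfaP (R : realType) (m s K : nat)
    (v : 'I_K -> 'rV[R]_m) (u : 'I_K -> 'rV[R]_s) (psi : 'I_K -> R)
    (p tp : iovec R m s) :
  (0 < s)%N -> (forall k, vlt 0 (v k)) -> (forall k, vlt 0 (u k)) ->
  vlt 0 p.1 -> vlt 0 p.2 ->
  vle 0 tp.1 -> vle tp.1 (const_mx 1) -> vle (const_mx 1) tp.2 ->
  (forall k, hyp (v k) (u k) (psi k) (project p tp) <= 0) ->
  (exists k, hyp (v k) (u k) (psi k) (project p tp) = 0) ->
  max_rm_feasible (pps_exfa v u psi) p tp.
Proof.
move=> s_gt0 v0 u0 p1 p2 t0 t1 f1 le0 eq0; split=> //.
apply/strong_frontier_exfaP => //; split=> //; apply/pps_exfaE; split=> // i /=.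
  by have := p1 i; have := t0 i; rewrite !mxE => ? ?; rewrite mulr_ge0 // ltW.
have := p2 i; have := f1 i; rewrite !mxE => f1i p2i.
by rewrite mulr_ge0 ?(ltW p2i) // (le_trans ler01).
Qed.

Lemma sum_delta (R : realType) (d : nat) (i : 'I_d) (a : 'I_d -> R) (N : R) :
  \sum_j a j * (N *+ (j == i)) = a i * N.
Proof.
rewrite (bigD1 i) //= eqxx mulr1n big1 ?addr0 // => j /negPf ->.
by rewrite mulr0n mulr0.
Qed.

(** Moving a single coordinate up to its intercept yields a feasible solution,
    whose loss is at least the optimal one.  For input i with intercept N, the
    loss is N; if N > 1 the move is infeasible, but then N exceeds the loss
    anyway.  For output r with intercept N, the loss is [1 - (1 + N)^-1 < 1],
    and [loss tp <= 1 - (1 + N)^-1] rearranges to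
    [loss tp <= (1 - loss tp) * N]. *)
Lemma optimal_loss_bounds (R : realType) (m s K : nat)
    (v : 'I_K -> 'rV[R]_m) (u : 'I_K -> 'rV[R]_s) (psi : 'I_K -> R)
    (p tp : iovec R m s) :
  (0 < s)%N -> (0 < K)%N ->
  (forall k, vlt 0 (v k)) -> (forall k, vlt 0 (u k)) ->
  vlt 0 p.1 -> vlt 0 p.2 -> pps_exfa v u psi p ->
  max_rm_optimal (pps_exfa v u psi) p tp ->
  [/\ loss tp < 1,
      forall k i, v k 0 i * p.1 0 i * loss tp <= - hyp (v k) (u k) (psi k) p &
      forall k r, u k 0 r * p.2 0 r * loss tp <=
        (1 - loss tp) * - hyp (v k) (u k) (psi k) p].
Proof.
move=> s_gt0 K_gt0 v0 u0 p1 p2 /pps_exfaE[_ _ Tp] [_ opt].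
have best tp' : max_rm_feasible (pps_exfa v u psi) p tp' -> loss tp <= loss tp'.
  by move=> /opt; apply: max_rm_obj_loss.
have c0 k : 0 <= - hyp (v k) (u k) (psi k) p by rewrite oppr_ge0.
have a0 k i : 0 < v k 0 i * p.1 0 i.
  by have := v0 k i; have := p1 i; rewrite !mxE => *; apply: mulr_gt0.
have b0 k r : 0 < u k 0 r * p.2 0 r.
  by have := u0 k r; have := p2 r; rewrite !mxE => *; apply: mulr_gt0.
have out r : exists N, [/\ 0 <= N, loss tp <= 1 - (1 + N)^-1 &
    forall k, u k 0 r * p.2 0 r * N <= - hyp (v k) (u k) (psi k) p].
  have [N [N0 Nle [k Nk]]] := intercept (Ordinal K_gt0) (b0^~ r) c0.
  exists N; split=> //.
  pose tp' : iovec R m s := (const_mx 1, \row_j (1 + N *+ (j == r))).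
  have hypE j : hyp (v j) (u j) (psi j) (project p tp') =
      hyp (v j) (u j) (psi j) p + u j 0 r * p.2 0 r * N.
    rewrite hyp_project /= big1 ?add0r => [|i _]; last first.
      by rewrite mxE subrr mulr0.
    rewrite -(sum_delta r (fun i => u j 0 i * p.2 0 i)); congr (_ + _).
    by apply: eq_bigr => i _; rewrite mxE addrAC subrr add0r.
  have -> : 1 - (1 + N)^-1 = loss tp'.
    rewrite /loss /= big1 ?add0r => [|i _]; last by rewrite mxE subrr.
    rewrite (bigD1 r) //= mxE eqxx big1 ?addr0 // => i /negPf ir.
    by rewrite mxE ir addr0 invr1 subrr.
  apply/best/max_rm_feasible_exfaP => //=.
  - by move=> i; rewrite !mxE.
  - by move=> i; rewrite !mxE lerDl mulrn_wge0.
  - by move=> j; rewrite hypE; have := Nle j; lra.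
  - by exists k; rewrite hypE; lra.
have lt1 : loss tp < 1.
  have [N [N0 le _]] := out (Ordinal s_gt0).
  by apply: le_lt_trans le _; rewrite ltrBlDr ltrDl invr_gt0; lra.
split=> // k i.
  have [N [N0 Nle [l Nl]]] := intercept (Ordinal K_gt0) (a0^~ i) c0.
  apply: le_trans (Nle k); rewrite ler_pM2l //.
  have [N1|N1] := leP N 1; last by rewrite ltW // (lt_trans lt1).
  pose tp' : iovec R m s := (\row_j (1 - N *+ (j == i)), const_mx 1).
  have hypE j : hyp (v j) (u j) (psi j) (project p tp') =
      hyp (v j) (u j) (psi j) p + v j 0 i * p.1 0 i * N.
    rewrite hyp_project /= [X in _ + (_ + X)]big1 ?addr0 => [|r _]; last first.
      by rewrite mxE subrr mulr0.
    rewrite -(sum_delta i (fun i => v j 0 i * p.1 0 i)); congr (_ + _).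
    by apply: eq_bigr => r _; rewrite mxE opprB addrC subrK.
  have -> : N = loss tp'.
    rewrite /loss /= [X in _ + X]big1 ?addr0 => [|r _]; last first.
      by rewrite mxE invr1 subrr.
    rewrite (bigD1 i) //= mxE eqxx big1 ?addr0 => [|r /negPf ri].
      by rewrite opprB addrC subrK.
    by rewrite mxE ri subr0 subrr.
  apply/best/max_rm_feasible_exfaP => //=.
  - by move=> r /=; rewrite !mxE; case: eqP => _; rewrite ?mulr1n ?mulr0n; lra.
  - by move=> r; rewrite !mxE gerBl mulrn_wge0.
  - by move=> j; rewrite hypE; have := Nle j; lra.
  - by exists l; rewrite hypE; lra.
have [N [N0 le Nle]] := out i.
have N1 : 0 < 1 + N by lra.
have le' : loss tp <= (1 - loss tp) * N.
  suff : loss tp * (1 + N) <= N by lra.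
  have -> : N = (1 - (1 + N)^-1) * (1 + N) by field; rewrite gt_eqF.
  rewrite [X in _ * X <= _](_ : _ = 1 + N) ?ler_pM2r //.
  by field; rewrite gt_eqF.
apply: le_trans (_ : u k 0 i * p.2 0 i * ((1 - loss tp) * N) <= _).
  by rewrite ler_pM2l.
by rewrite mulrCA ler_wpM2l // subr_ge0 ltW.
Qed.

(** * The projection is a closest target *)

Theorem corollary4p6 (R : realType) (m s n : nat)
  (m_gt0 : (0 < m)%N) (s_gt0 : (0 < s)%N) (n_gt0 : (0 < n)%N)
  (X : 'I_n -> 'rV[R]_m) (Y : 'I_n -> 'rV[R]_s)
  (X_gt0 : forall j, vlt 0 (X j)) (Y_gt0 : forall j, vlt 0 (Y j))
  (exFDEF : exists F, is_FDEF (pps X Y) F)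
  (K : nat) (F : 'I_K -> set ('rV[R]_m * 'rV[R]_s))
  (F_inj : injective F)
  (F_all : forall G, is_FDEF (pps X Y) G <-> exists k, G = F k)
  (v : 'I_K -> 'rV[R]_m) (u : 'I_K -> 'rV[R]_s) (psi : 'I_K -> R)
  (v_gt0 : forall k, vlt 0 (v k)) (u_gt0 : forall k, vlt 0 (u k))
  (F_eq : forall k, F k = cut (pps X Y) (v k) (u k) (psi k))
  (F_supp : forall k, supports (pps X Y) (v k) (u k) (psi k))
  (x : 'rV[R]_m) (y : 'rV[R]_s)
  (Pxy : pps X Y (x, y)) (x_gt0 : vlt 0 x) (y_gt0 : vlt 0 y)
  (theta : 'rV[R]_m) (phi : 'rV[R]_s)
  (opt : max_rm_optimal (pps_exfa v u psi) (x, y) (theta, phi)) :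
  let T := pps_exfa v u psi in
  let t := (scalev theta x, scalev phi y) in
  [/\ input_closest_target T (x, y) t \/ output_closest_target T (x, y) t,
      vlt 0 (scalev theta x) & ~ free_lunch T t].
Proof.
move=> T t.
have K_gt0 : (0 < K)%N.
  by have [G /F_all [k _]] := exFDEF; apply: leq_ltn_trans (ltn_ord k).
have Txy : T (x, y).
  by apply/pps_exfaE; have [? ? _] := Pxy; split=> // k; apply: F_supp.
have [lt1 in_bound out_bound] :=
  optimal_loss_bounds (p := (x, y)) s_gt0 K_gt0 v_gt0 u_gt0 x_gt0 y_gt0 Txy opt.
move: opt => [[/= th0 th1 ph1 strong_t] opt].
have best tp : max_rm_feasible T (x, y) tp -> loss (theta, phi) <= loss tp.
  by move=> /opt; apply: max_rm_obj_loss.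
set mu := loss _ in lt1 in_bound out_bound best.
have th1' i : 0 <= 1 - theta 0 i by have := th1 i; rewrite mxE subr_ge0.
have ph1' r : 1 <= phi 0 r by have := ph1 r; rewrite mxE.
have ph_gt0 r : 0 < phi 0 r by apply: lt_le_trans (ph1' r).
have h_ge0 r : 0 <= 1 - (phi 0 r)^-1 by rewrite subr_ge0 invf_le1.
have muE : mu = \sum_i (1 - theta 0 i) + \sum_r (1 - (phi 0 r)^-1) by [].
have sth_ge0 : 0 <= \sum_i (1 - theta 0 i) by apply: sumr_ge0.
have sph_ge0 : 0 <= \sum_r (1 - (phi 0 r)^-1) by apply: sumr_ge0.
have th_gt0 : vlt 0 (scalev theta x).
  move=> i; have := x_gt0 i; rewrite !mxE => xi; apply: mulr_gt0 => //.
  suff : 1 - theta 0 i <= \sum_i (1 - theta 0 i) by lra.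
  by rewrite (bigD1 i) //= lerDl sumr_ge0.
split=> //; last first.
  move=> [_ /= t0 _ _]; have := th_gt0 (Ordinal m_gt0).
  by rewrite t0 ltxx.
(* The single term 1 - 1/phi_r is at most the total mu, so 1/phi_r >= 1 - mu;
   multiply by phi_r - 1 >= 0. *)
have h_le r : (1 - mu) * (phi 0 r - 1) <= 1 - (phi 0 r)^-1.
  have -> : 1 - (phi 0 r)^-1 = (phi 0 r)^-1 * (phi 0 r - 1).
    by field; rewrite gt_eqF.
  apply: ler_wpM2r; first by rewrite subr_ge0.
  suff : 1 - (phi 0 r)^-1 <= mu by lra.
  have : 1 - (phi 0 r)^-1 <= \sum_r (1 - (phi 0 r)^-1).
    by rewrite (bigD1 r) //= lerDl sumr_ge0.
  by lra.
have scale1 d (a : 'rV[R]_d) : scalev (const_mx 1) a = a.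
  by apply/rowP => i; rewrite !mxE mul1r.
(* Either only inputs move, or some output r moves. *)
have [phi1|/existsNP[r phir]] := EM (forall r, phi 0 r = 1).
  have phiE : phi = const_mx 1 by apply/rowP => r; rewrite phi1 mxE.
  have mu_in : mu = \sum_i (1 - theta 0 i).
    by rewrite muE [X in _ + X]big1 ?addr0 // => r _; rewrite phi1 invr1 subrr.
  left; exists theta; split; last by rewrite /t phiE scale1.
  split.
    split=> //; have := strong_weak_frontier m_gt0 strong_t.
    by rewrite /project /= phiE scale1.
  move=> th' [weak th'0 th'1]; rewrite /holder_in_obj -mu_in.
  (* A competitor with positive inputs is max RM feasible; one with a zero
     input has distance at least 1. *)
  have [pos|/existsNP[i th'i]] := EM (vlt 0 th').
    have -> : \sum_i (1 - th' 0 i) = loss (th', const_mx 1 : 'rV[R]_s).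
      rewrite /loss /= [X in _ + X]big1 ?addr0 // => r _.
      by rewrite mxE invr1 subrr.
    apply: best; split=> [//|//|r /=|]; first by rewrite !mxE.
    rewrite /project /= scale1; apply: weak_strong_frontier_exfa => //= i.
    by have := pos i; have := x_gt0 i; rewrite !mxE => *; apply: mulr_gt0.
  apply: le_trans (ltW lt1) _.
  rewrite (bigD1 i) //=.
  have -> : th' 0 i = 0.
    apply/eqP; rewrite eq_le; have := th'0 i; rewrite mxE => ->.
    by rewrite andbT leNgt; move/negP: th'i; rewrite mxE.
  rewrite subr0 lerDl; apply: sumr_ge0 => j _.
  by have := th'1 j; rewrite mxE subr_ge0.
have hr_gt0 : 0 < 1 - (phi 0 r)^-1.
  have : 1 < phi 0 r by rewrite lt_neqAle ph1' andbT eq_sym; apply/eqP.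
  by move=> ?; rewrite subr_gt0 invf_lt1.
have mu_gt0 : 0 < mu.
  by rewrite muE ltr_wpDl // (bigD1 r) //= ltr_pwDl // sumr_ge0.
(* u_kr y_r mu > 0 is bounded by (1 - mu) c_k, so no slack vanishes. *)
have c_gt0 k : 0 < - hyp (v k) (u k) (psi k) (x, y).
  have b0 : 0 < u k 0 r * y 0 r.
    by have := u_gt0 k r; have := y_gt0 r; rewrite !mxE => *; apply: mulr_gt0.
  have : 0 < (1 - mu) * - hyp (v k) (u k) (psi k) (x, y).
    by apply: lt_le_trans (out_bound k r); apply: mulr_gt0.
  by rewrite pmulr_rgt0 // subr_gt0.
(* A frontier point spends exactly c_k on its hyperplane k; bound every unit of
   expense by the column bounds and cancel c_k. *)
have price k (th : 'rV[R]_m) (ph : 'rV[R]_s) :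
    vle th (const_mx 1) -> vle (const_mx 1) ph ->
    hyp (v k) (u k) (psi k) (project (x, y) (th, ph)) = 0 ->
    mu <= \sum_i (1 - th 0 i) + (1 - mu) * \sum_r (ph 0 r - 1).
  move=> th_le1 ph_ge1; rewrite hyp_project /= => /eqP.
  rewrite addrC addr_eq0 => /eqP ck.
  rewrite -(ler_pM2l (c_gt0 k)) -{1}ck mulrDl [leRHS]mulrDr; apply: lerD.
    rewrite mulr_suml mulr_sumr; apply: ler_sum => i _.
    rewrite mulrAC; apply: ler_wpM2r (in_bound k i).
    by have := th_le1 i; rewrite mxE subr_ge0.
  rewrite mulr_suml !mulr_sumr; apply: ler_sum => j _.
  rewrite mulrAC mulrA [X in _ <= X * _]mulrC; apply: ler_wpM2r (out_bound k j).
  by have := ph_ge1 j; rewrite mxE subr_ge0.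
have [k Hk] : exists k,
    hyp (v k) (u k) (psi k) (project (x, y) (theta, phi)) = 0.
  by have [] := (strong_frontier_exfaP psi
    (project (x, y) (theta, phi)) s_gt0 v_gt0 u_gt0).1 strong_t.
have sum_eq : \sum_r ((1 - (phi 0 r)^-1) - (1 - mu) * (phi 0 r - 1)) = 0.
  apply/eqP; rewrite eq_le; apply/andP; split; last first.
    by apply: sumr_ge0 => j _; rewrite subr_ge0.
  rewrite sumrB -mulr_sumr; have := price _ _ _ th1 ph1 Hk; lra.
(* All terms of the vanishing sum are nonnegative; the one at r is
   (phi_r - 1) (mu - (1 - 1/phi_r)) with phi_r - 1 <> 0. *)
have h_eq : 1 - (phi 0 r)^-1 = mu.
  move/eqP: sum_eq; rewrite psumr_eq0 => [|j _]; last by rewrite subr_ge0.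
  move=> /allP /(_ r (mem_index_enum r)) /eqP.
  have -> : 1 - (phi 0 r)^-1 - (1 - mu) * (phi 0 r - 1) =
      (phi 0 r - 1) * (mu - (1 - (phi 0 r)^-1)).
    by field; rewrite gt_eqF.
  move/eqP; rewrite mulf_eq0 !subr_eq0 => /orP[/eqP //|/eqP].
  by [].
(* The single term at r already exhausts mu. *)
have sth0 : \sum_i (1 - theta 0 i) = 0.
  have : 1 - (phi 0 r)^-1 <= \sum_r (1 - (phi 0 r)^-1).
    by rewrite (bigD1 r) //= lerDl sumr_ge0.
  by lra.
have thE : theta = const_mx 1.
  apply/rowP => i; move/eqP: sth0; rewrite psumr_eq0 //.
  move=> /allP /(_ i (mem_index_enum i)).
  by rewrite mxE subr_eq0 => /eqP <-.
right; exists phi; split; last by rewrite /t thE scale1.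
split.
  split=> //; have := strong_weak_frontier m_gt0 strong_t.
  by rewrite /project /= thE scale1.
move=> ph' [weak ph'1].
have [_ [l Hl]] := (strong_frontier_exfaP psi _ s_gt0 v_gt0 u_gt0).1
  (weak_strong_frontier_exfa (p := (x, scalev ph' y)) s_gt0 v_gt0 u_gt0 x_gt0
     weak).
have : mu <= \sum_i (1 - (const_mx 1 : 'rV[R]_m) 0 i) +
    (1 - mu) * \sum_r (ph' 0 r - 1).
  apply: (price l) => //.
  by rewrite /project /= scale1.
rewrite big1 ?add0r => [le'|i _]; last by rewrite mxE subrr.
have one_mu : 0 < 1 - mu by rewrite subr_gt0.
rewrite /holder_out_obj -(ler_pM2l one_mu); apply: le_trans le'.
move: sum_eq; rewrite sumrB -mulr_sumr; lra.
Qed.
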